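(* Let $L^{Tik}$ and $L^{Tik}_N$ be the expected and empirical Tikhonov regularized losses $$L^{Tik}(u)=\mathbb{E}_{\rho_x}\big(D(u(x),y(x))+|\nabla u(x)|^2\big),\ u\in U,\qquad L^{Tik}_N(\phi)=\frac1N\sum_{i=1}^N\big(D(\phi(x_i),y(x_i))+|\nabla \phi(x_i)|^2\big),\ \phi\in V,$$ where $x_1,\dots,x_N$ are i.i.d. samples from $\rho_x$ and $V\subset U$. Suppose that $D$ is $\lambda$-Lipschitz in its first argument, i.e. $|D(u_1(x),y(x))-D(u_2(x),y(x))|\le\lambda|u_1(x)-u_2(x)|$ for all $u_1,u_2\in U$ and $x\in\Omega$. Let $\hat u\in U$ be the minimizer of $L^{Tik}$ over $U$, let $\hat\phi\in V$ be a $\delta$-minimizer of $L^{Tik}$ over $V$, and let $\hat\phi^N\in V$ be a $\delta$-minimizer of $L^{Tik}_N$ over $V$. Assume: (A1) (approximation error) there exists $\phi\in V$ with $\|\phi-\hat u\|_{H^1(\rho_x)}^2\le C_1^2\,\|\hat u\|_*^2/m^{\gamma}$; (A2) (quadrature error) for every $0<\epsilon<1$, with probability at least $1-\epsilon$ over the choice of $x_1,\dots,x_N$, $\ \sup_{\phi\in V}|L^{Tik}(\phi)-L^{Tik}_N(\phi)|\le C_2(V,m,\epsilon)/\sqrt N$. Then, with $\|\nabla\hat u\|_2=\sqrt{\mathbb{E}_{\rho_x}(|\nabla\hat u|^2)}$: (a) $$0\le L^{Tik}(\hat\phi)-L^{Tik}(\hat u)\le(\lambda+2\|\nabla\hat u\|_2)C_1\frac{\|\hat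 u\|_*}{m^{\gamma/2}}+C_1^2\frac{\|\hat u\|_*^2}{m^{\gamma}}+\delta .$$ (b) For every $0<\epsilon<1$, with probability at least $1-\epsilon$ over the choice of $x_1,\dots,x_N$, $$0\le L^{Tik}(\hat\phi^N)-L^{Tik}(\hat u)\le(\lambda+2\|\nabla\hat u\|_2)C_1\frac{\|\hat u\|_*}{m^{\gamma/2}}+C_1^2\frac{\|\hat u\|_*^2}{m^{\gamma}}+\frac{2C_2(V,m,\epsilon)}{\sqrt N}+2\delta .$$
   Context: $\Omega\subset\mathbb{R}^d$ is a bounded domain, $\rho_x$ a probability distribution on $\Omega$, $y$ a given target function on $\Omega$, and $D(\cdot,\cdot)$ a real-valued data-fitting loss. $U$ is a function space of functions $u:\Omega\to\mathbb{R}^n$ ($n\ge1$) for which the gradient is defined and the expectations of $D(u,y)$ and $|\nabla u|^2$ are well defined and finite. $V\subset U$ is a set (of neural networks with finitely many parameters). $|\cdot|$ is the Euclidean norm (of vectors, and of the gradient/Jacobian viewed as a vector). The norm is $\|v\|_{H^1(\rho_x)}^2:=\mathbb{E}_{\rho_x}(|v|^2+|\nabla v|^2)$. $\|\cdot\|_*$ is the norm of some given space containing $\hat u$; $C_1\geq 0$ is a constant, $m>0$ is a constant (related to the number of parameters of the networks in $V$), $\gamma$ is a constant order, and $C_2(V,m,\epsilon)$ is a constant depending on $V,m,\epsilon$ (and possibly other factors such as $d$), but not on the sample. For a functional $L$ on a set $W$ and $\delta\ge0$, $\hat w\in W$ is a $\delta$-minimizer of $L$ over $W$ if $L(\hat w)\le\inf_{w\in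 W}L(w)+\delta$. *)

(* Defs.v *)
From HB Require Import structures.
From mathcomp Require Export all_boot all_order all_algebra.
From mathcomp Require Export all_classical all_reals all_analysis.

Set Implicit Arguments.
Unset Strict Implicit.
Unset Printing Implicit Defensive.

Import Order.TTheory GRing.Theory Num.Theory.
Export numFieldNormedType.Exports.

Local Open Scope classical_set_scope.
Local Open Scope ring_scope.

(* R^d with its Borel sigma-algebra; the library has no canonical measurable
   structure on row vectors. *)
Definition borel (R : realType) (d : nat) :=
  g_sigma_algebraType (@open 'rV[R]_d).

(* A function Om -> R^n is represented by a total function on R^d, whose values
   outside Om are irrelevant: Om is open and has full measure. *)
Definition vfun (R : realType) (d n : nat) := 'rV[R]_d -> 'rV[R]_n.

Definition bounded_domain (R : realType) (d : nat) (Om : set 'rV[R]_d) : Prop :=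
  [/\ Om !=set0, open Om, connected Om & bounded_set Om].

(* The library norm `|A| on matrices is the max norm; this is the Euclidean one,
   used both for row vectors and for Jacobians. *)
Definition l2norm (R : realType) (p q : nat) (A : 'M[R]_(p, q)) : R :=
  Num.sqrt (\sum_(i < p) \sum_(j < q) A i j ^+ 2).

(* Matrix of partial derivatives: entry (j, i) is the j-th partial derivative of
   the i-th component.  It is equal to the library's [jacobian u x] when u is
   differentiable at x, but only needs the partial derivatives to exist
   (where they do not, its entries are the library's default values). *)
Definition grad (R : realType) (d n : nat) (u : vfun R d n) (x : 'rV[R]_d) :
    'M[R]_(d, n) :=
  \matrix_(j < d, i < n) derive u x (delta_mx 0 j) 0 i.

Definition has_grad (R : realType) (d n : nat) (u : vfun R d n)
    (x : 'rV[R]_d) : Prop :=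
  forall j : 'I_d, derivable u x (delta_mx 0 j).

(* Integrand of both losses. *)
Definition tik_density (R : realType) (d n : nat) (Y : Type)
    (D : 'rV[R]_n -> Y -> R) (y : 'rV[R]_d -> Y) (u : vfun R d n)
    (x : 'rV[R]_d) : R :=
  D (u x) (y x) + l2norm (grad u x) ^+ 2.

Definition expected_tik (R : realType) (d n : nat) (Y : Type)
    (Om : set 'rV[R]_d) (rho : probability (borel R d) R)
    (D : 'rV[R]_n -> Y -> R) (y : 'rV[R]_d -> Y) (u : vfun R d n) : R :=
  \int[rho]_(x in Om) tik_density D y u x.

Definition empirical_tik (R : realType) (d n N : nat) (Y : Type)
    (D : 'rV[R]_n -> Y -> R) (y : 'rV[R]_d -> Y) (x : 'I_N -> 'rV[R]_d)
    (phi : vfun R d n) : R :=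
  N%:R^-1 * \sum_(i < N) tik_density D y phi (x i).

(* The gradient is defined rho-almost everywhere in Om (piecewise smooth networks
   are thus allowed when rho does not charge their kinks), and E D(u,y) and
   E |grad u|^2 are finite. *)
Definition admissible (R : realType) (d n : nat) (Y : Type)
    (Om : set 'rV[R]_d) (rho : probability (borel R d) R)
    (D : 'rV[R]_n -> Y -> R) (y : 'rV[R]_d -> Y) (u : vfun R d n) : Prop :=
  [/\ {ae rho, forall x, Om x -> has_grad u x},
      rho.-integrable Om (fun x => (D (u x) (y x))%:E) &
      rho.-integrable Om (fun x => (l2norm (grad u x) ^+ 2)%:E)].

(* Extended-real valued: E |v|^2 may be infinite for a difference of admissible
   functions.  Measurability of v is not part of [admissible]; for a nonmeasurable
   integrand >= 0 the library's integral is the lower integral. *)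
Definition H1norm2 (R : realType) (d n : nat) (Om : set 'rV[R]_d)
    (rho : probability (borel R d) R) (v : vfun R d n) : \bar R :=
  (\int[rho]_(x in Om) (l2norm (v x) ^+ 2 + l2norm (grad v x) ^+ 2)%:E)%E.

Definition grad_L2norm (R : realType) (d n : nat) (Om : set 'rV[R]_d)
    (rho : probability (borel R d) R) (u : vfun R d n) : R :=
  Num.sqrt (\int[rho]_(x in Om) (l2norm (grad u x) ^+ 2)).

(* S is a linear space of functions on Om and iota identifies each of them with
   an element of the normed space W; W may consist of equivalence classes of
   functions, and iota u only depends on the values of u on Om. *)
Definition functions_in_normed_space (R : realType) (d n : nat)
    (Om : set 'rV[R]_d) (W : normedModType R) (S : set (vfun R d n))
    (iota : vfun R d n -> W) : Prop :=
  [/\ S (fun=> 0),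
      forall (a : R) (u v : vfun R d n), S u -> S v ->
        S (fun x => a *: u x + v x) /\
        iota (fun x => a *: u x + v x) = a *: iota u + iota v &
      forall u v : vfun R d n, S u -> S v ->
        (forall x, Om x -> u x = v x) -> iota u = iota v].

Definition minimizer (R : realType) (T : Type) (L : T -> R) (W : set T)
    (w : T) : Prop :=
  W w /\ forall v, W v -> L w <= L v.

(* The infimum is taken in the extended reals, since the library's [inf] of a
   set of reals unbounded below is 0. *)
Definition delta_minimizer (R : realType) (T : Type) (L : T -> R) (W : set T)
    (delta : R) (w : T) : Prop :=
  W w /\ ((L w)%:E <= ereal_inf [set (L v)%:E | v in W] + delta%:E)%E.

Definition iid_sample (R : realType) (d N : nat) (dT : measure_display)
    (T : measurableType dT) (P : probability T R)
    (X : 'I_N -> {RV P >-> borel R d}) (rho : probability (borel R d) R) :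
    Prop :=
  (forall (i : 'I_N) (A : set (borel R d)),
     measurable A -> distribution P (X i) A = rho A) /\
  (forall (J : {set 'I_N}) (A : 'I_N -> set (borel R d)),
     (forall i, measurable (A i)) ->
     P (\bigcap_(i in [set i | i \in J]) (X i @^-1` A i)) =
     (\prod_(i in J) P (X i @^-1` A i))%E).

(* A need not be measurable (it may involve a supremum over an uncountable set);
   for measurable A this says p <= P A. *)
Definition with_prob_ge (R : realType) (dT : measure_display)
    (T : measurableType dT) (P : probability T R) (p : R) (A : set T) : Prop :=
  exists2 E : set T, measurable E /\ E `<=` A & (p%:E <= P E)%E.

(* Main.v *)
(* Compare an arbitrary competitor phi in V, the one given by (A1), with uhat.
   With a = |grad phi|, b = |grad uhat| and h = a - b, the reverse triangle
   inequality gives |h| <= |grad (phi - uhat)|, and a^2 - b^2 = 2 b h + h^2, so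
   Cauchy-Schwarz bounds L phi - L uhat by (lambda + 2 |grad uhat|_2) e + e^2,
   where e = C1 |uhat|_* / m^(gamma/2).  The difference phi - uhat need not be
   measurable, so the H^1 bound is only used on measurable functions dominated
   by its integrand: h^2 and the square of |D(phi, y) - D(uhat, y)| / lambda.
   Passing to the delta-minimizers costs delta, plus twice the quadrature error
   in the empirical case. *)
Require Import Defs.
From mathcomp Require Import all_boot all_order all_algebra.
From mathcomp Require Import all_classical all_reals all_analysis.
From mathcomp Require Import measurable_realfun ring lra.

Import Order.TTheory GRing.Theory Num.Theory.
Import numFieldNormedType.Exports.

Local Open Scope classical_set_scope.
Local Open Scope ring_scope.

Set Implicit Arguments.
Unset Strict Implicit.

(** * Cauchy-Schwarz and the Euclidean norm of matrices *)

(** A nonnegative quadratic has nonpositive discriminant. This is the common core of the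
    Cauchy-Schwarz inequalities for matrices and for integrals. *)
Lemma le_sqrtM_of_quadratic_ge0 (R : realType) (a b c : R) : 0 <= a -> 0 <= b ->
  (forall t, 0 <= a * t ^+ 2 - 2 * c * t + b) -> c <= Num.sqrt a * Num.sqrt b.
Proof.
move=> a0 b0 H; rewrite -sqrtrM//.
have : (- (2 * c)) ^+ 2 - 4 * a * b <= 0.
  pose p := Poly [:: b; - (2 * c); a].
  have -> : a = p`_2 by rewrite !coefE.
  have -> : - (2 * c) = p`_1 by rewrite !coefE.
  have -> : b = p`_0 by rewrite !coefE.
  apply: deg_le2_poly_ge0; first by rewrite size_Poly.
  move=> t; rewrite horner_Poly/=; have := H t; lra.
move=> K; apply: (le_trans (ler_norm c)); rewrite -sqrtr_sqr ler_wsqrtr//; lra.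
Qed.

Lemma sqr_l2norm (R : realType) (p q : nat) (A : 'M[R]_(p, q)) :
  l2norm A ^+ 2 = \sum_(i < p) \sum_(j < q) A i j ^+ 2.
Proof.
rewrite /l2norm sqr_sqrtr// sumr_ge0// => i _.
by rewrite sumr_ge0// => j _; exact: sqr_ge0.
Qed.

Lemma l2norm_ge0 (R : realType) (p q : nat) (A : 'M[R]_(p, q)) : 0 <= l2norm A.
Proof. exact: sqrtr_ge0. Qed.

(** Nonnegativity of [l2norm (t *: A - B) ^+ 2] in [t] gives Cauchy-Schwarz for the entrywise
    product [c]; the expansion at [t = 1] then concludes. *)
Lemma ler_sqr_dist_l2norm (R : realType) (p q : nat) (A B : 'M[R]_(p, q)) :
  (l2norm A - l2norm B) ^+ 2 <= l2norm (A - B) ^+ 2.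
Proof.
pose c := \sum_(i < p) \sum_(j < q) A i j * B i j.
have quad t : l2norm (t *: A - B) ^+ 2 =
    l2norm A ^+ 2 * t ^+ 2 - 2 * c * t + l2norm B ^+ 2.
  rewrite !sqr_l2norm /c -mulrA !mulr_suml mulr_sumr -sumrB -big_split/=.
  apply: eq_bigr => i _; rewrite !mulr_suml mulr_sumr -sumrB -big_split/=.
  by apply: eq_bigr => j _; rewrite !mxE; ring.
have : c <= Num.sqrt (l2norm A ^+ 2) * Num.sqrt (l2norm B ^+ 2).
  apply: le_sqrtM_of_quadratic_ge0; rewrite ?sqr_ge0// => t.
  by rewrite -quad sqr_ge0.
rewrite !sqrtr_sqr !ger0_norm ?l2norm_ge0// => cAB.
have := quad 1; rewrite scale1r => ->; nra.
Qed.

(** * Integral inequalities, with possibly nonmeasurable majorants *)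

Section integral_inequalities.
Context {dT : measure_display} {T : measurableType dT} {R : realType}.
Variable mu : {measure set T -> \bar R}.
Variable D : set T.
Hypothesis mD : measurable D.

(* [F] need not be measurable: its integral is the supremum of the integrals of
   the simple functions below it, which is all the proof uses. *)
Lemma ge0_ae_le_integral_nonmeas (k F : T -> \bar R) :
  measurable_fun D k -> (forall x, D x -> 0 <= k x)%E ->
  (forall x, D x -> 0 <= F x)%E ->
  {ae mu, forall x, D x -> (k x <= F x)%E} ->
  (\int[mu]_(x in D) k x <= \int[mu]_(x in D) F x)%E.
Proof.
move=> mk k0 F0 [N [mN N0 kFN]].
rewrite (ge0_negligible_integral mN)//.
rewrite !ge0_integralE//; last by move=> x [/k0].
(* A simple function below [k] cut off outside [D] minus [N] is also below [F] extended by 0: where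
   [k] is cut off, it is at most 0. *)
apply: ereal_sup_le => _ [h /= hk <-]; exists h => //= x.
apply: (le_trans (hk x)); rewrite /patch.
case: ifPn => [/set_mem[Dx Nx]|_].
- rewrite mem_set//; apply/not_notP => kF; apply: Nx; apply: kFN => /=.
  by move=> /(_ Dx) ?; exact: kF.
- by case: ifPn => // /set_mem /F0.
Qed.

Lemma integrable_mul_sqr (f g : T -> R) :
  measurable_fun D f -> measurable_fun D g ->
  mu.-integrable D (fun x => (f x ^+ 2)%:E) ->
  mu.-integrable D (fun x => (g x ^+ 2)%:E) ->
  mu.-integrable D (fun x => (f x * g x)%:E).
Proof.
move=> mf mg f2 g2.
apply: (le_integrable mD _ _ (integrableD mD f2 g2)).
- by apply/measurable_EFinP; exact: measurable_funM.
- move=> x Dx /=; rewrite lee_fin [leRHS]ger0_norm ?addr_ge0 ?sqr_ge0//.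
  rewrite ler_norml; apply/andP; split; nra.
Qed.

(** The integral of [(t * f - g) ^+ 2] is a nonnegative quadratic in [t]. *)
Lemma Rintegral_cauchy_schwarz (f g : T -> R) :
  measurable_fun D f -> measurable_fun D g ->
  mu.-integrable D (fun x => (f x ^+ 2)%:E) ->
  mu.-integrable D (fun x => (g x ^+ 2)%:E) ->
  \int[mu]_(x in D) (f x * g x) <=
  Num.sqrt (\int[mu]_(x in D) (f x ^+ 2)) *
  Num.sqrt (\int[mu]_(x in D) (g x ^+ 2)).
Proof.
move=> mf mg f2 g2; have fg := integrable_mul_sqr mf mg f2 g2.
have I2 (h : T -> R) : 0 <= \int[mu]_(x in D) (h x ^+ 2).
  by apply: Rintegral_ge0 => x _; exact: sqr_ge0.
apply: le_sqrtM_of_quadratic_ge0; rewrite ?I2// => t.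
have f2t : mu.-integrable D (EFin \o (fun x => t ^+ 2 * f x ^+ 2)).
  exact: (integrableZl mD (t ^+ 2) f2).
have fgt : mu.-integrable D (EFin \o (fun x => 2 * t * (f x * g x))).
  exact: (integrableZl mD (2 * t) fg).
have := I2 (fun x => t * f x - g x).
under eq_Rintegral => x _.
  rewrite (_ : _ ^+ 2 = t ^+ 2 * f x ^+ 2 - 2 * t * (f x * g x) + g x ^+ 2);
    last by ring.
  over.
rewrite RintegralD//; last exact: (integrableB mD f2t fgt).
rewrite RintegralB// !RintegralZl//.
by congr (0 <= _ + _); ring.
Qed.

(** Integrability of a squared gradient norm yields measurability of the square only; this recovers
    the norm itself. *)
Lemma measurable_sqrt_sqr (f : T -> R) : (forall x, 0 <= f x) ->
  measurable_fun D (fun x => f x ^+ 2) -> measurable_fun D f.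
Proof.
move=> f0 mf; have -> : f = Num.sqrt \o (fun x => f x ^+ 2).
  by apply/funext => x /=; rewrite sqrtr_sqr ger0_norm.
apply: measurableT_comp => //; apply: continuous_measurable_fun.
exact: sqrt_continuous.
Qed.

(** Transfers a bound on the integral of the H^1 integrand [F] to a measurable function whose square
    it dominates; the finite bound also makes that square integrable. *)
Lemma Rintegral_sqr_le (f F : T -> R) (e : R) :
  measurable_fun D f -> (forall x, D x -> 0 <= F x) -> 0 <= e ->
  {ae mu, forall x, D x -> f x ^+ 2 <= F x} ->
  (\int[mu]_(x in D) (F x)%:E <= (e ^+ 2)%:E)%E ->
  mu.-integrable D (fun x => (f x ^+ 2)%:E) /\
  Num.sqrt (\int[mu]_(x in D) (f x ^+ 2)) <= e.
Proof.
move=> mf F0 e0 fF Fe.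
have mf2 : measurable_fun D (fun x => (f x ^+ 2)%:E).
  by apply/measurable_EFinP; exact: measurable_funX.
have fe : (\int[mu]_(x in D) (f x ^+ 2)%:E <= (e ^+ 2)%:E)%E.
  apply: le_trans Fe; apply: ge0_ae_le_integral_nonmeas => //.
  by move=> x _; rewrite lee_fin sqr_ge0.
have int : mu.-integrable D (fun x => (f x ^+ 2)%:E).
  apply/integrableP; split => //.
  under eq_integral do rewrite gee0_abs ?lee_fin ?sqr_ge0//.
  by rewrite (le_lt_trans fe)// ltry.
split => //; rewrite -(ger0_norm e0) -sqrtr_sqr ler_wsqrtr//.
by rewrite -lee_fin /Rintegral fineK// integrable_fin_num.
Qed.

End integral_inequalities.

(** * Comparison of the expected losses of two functions *)

(** The loss estimate with functions abstracted: [f] and [g] stand for the data terms, [a] and [b]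
    for the gradient norms, [v] for the distance of the values, [F] for the H^1 integrand of the
    difference. *)
Lemma Rintegral_add_sqr_sub_le {dT : measure_display} {T : measurableType dT}
    {R : realType} (P : probability T R) (A : set T) (f g v a b F : T -> R)
    (l e : R) :
  measurable A -> 0 <= l -> 0 <= e ->
  P.-integrable A (fun x => (f x)%:E) -> P.-integrable A (fun x => (g x)%:E) ->
  (forall x, 0 <= a x) -> P.-integrable A (fun x => (a x ^+ 2)%:E) ->
  (forall x, 0 <= b x) -> P.-integrable A (fun x => (b x ^+ 2)%:E) ->
  (forall x, 0 <= v x) ->
  (forall x, A x -> `|f x - g x| <= l * v x) ->
  (forall x, A x -> v x ^+ 2 <= F x) ->
  {ae P, forall x, A x -> (a x - b x) ^+ 2 <= F x} ->
  (\int[P]_(x in A) (F x)%:E <= (e ^+ 2)%:E)%E ->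
  \int[P]_(x in A) (f x + a x ^+ 2) - \int[P]_(x in A) (g x + b x ^+ 2)
    <= (l + 2 * Num.sqrt (\int[P]_(x in A) (b x ^+ 2))) * e + e ^+ 2.
Proof.
move=> mA l0 e0 fi gi a0 ia2 b0 ib2 v0 fg vF abF Fe.
pose G := Num.sqrt (\int[P]_(x in A) (b x ^+ 2)); rewrite -/G.
pose h x := a x - b x.
(* For [l = 0] the inverse is 0, so [k = 0]; this is harmless since [f = g] on
   [A] in that case. *)
pose k x := l^-1 * `|f x - g x|.
have F0 x : A x -> 0 <= F x by move=> /vF; apply: le_trans; exact: sqr_ge0.
have mr (q : T -> R) : P.-integrable A (EFin \o q) -> measurable_fun A q.
  by move=> /measurable_int /measurable_EFinP.
have ma : measurable_fun A a by apply: measurable_sqrt_sqr => //; exact: mr.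
have mb : measurable_fun A b by apply: measurable_sqrt_sqr => //; exact: mr.
have mh : measurable_fun A h by exact: measurable_funB.
have mk : measurable_fun A k.
  apply: measurable_funM => //; apply: measurableT_comp => //.
  by apply: measurable_funB; exact: mr.
have kv x : A x -> 0 <= k x <= v x.
  move=> Ax; have := fg _ Ax; rewrite /k; move: l0.
  rewrite le_eqVlt => /predU1P[<- _|l0 le].
    by rewrite invr0 mul0r lexx v0.
  by rewrite mulr_ge0 ?invr_ge0 ?(ltW l0)//= ler_pdivrMl.
have kF : {ae P, forall x, A x -> k x ^+ 2 <= F x}.
  apply: aeW => x Ax; have /andP[k0 kvx] := kv _ Ax.
  by apply: le_trans (vF _ Ax); rewrite lerXn2r// nnegrE.
have [ik2 ke] := Rintegral_sqr_le mA mk F0 e0 kF Fe.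
have [ih2 he] := Rintegral_sqr_le mA mh F0 e0 abF Fe.
(* Cauchy-Schwarz against the constant 1, on a set of mass at most 1, turns the mean-square bound on
   [k] into a bound on its mean. *)
pose one (x : T) : R := 1.
have P1 : Num.sqrt (\int[P]_(x in A) (one x ^+ 2)) <= 1.
  rewrite -[leRHS]sqrtr1 ler_wsqrtr// /one expr1n Rintegral_cst// mul1r.
  by rewrite -lee_fin fineK ?fin_num_measure// probability_le1.
have i1 : P.-integrable A (fun x => (one x ^+ 2 : R)%:E).
  by rewrite /one/= expr1n; exact: finite_measure_integrable_cst.
have m1 : measurable_fun A one by exact: measurable_cst.
have ik1 := integrable_mul_sqr mA mk m1 ik2 i1.
have ibh := integrable_mul_sqr mA mb mh ib2 ih2.
have kint : \int[P]_(x in A) (k x * one x) <= e.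
  apply: (le_trans (Rintegral_cauchy_schwarz mA mk m1 ik2 i1)).
  by rewrite -[leRHS]mulr1 ler_pM.
have bhint : \int[P]_(x in A) (b x * h x) <= G * e.
  apply: (le_trans (Rintegral_cauchy_schwarz mA mb mh ib2 ih2)).
  by rewrite ler_wpM2l.
have hint : \int[P]_(x in A) (h x ^+ 2) <= e ^+ 2.
  rewrite -[leLHS]sqr_sqrtr; last by apply: Rintegral_ge0 => x _; exact:sqr_ge0.
  by rewrite lerXn2r ?nnegrE.
have Dint : \int[P]_(x in A) (f x - g x) <= l * e.
  apply: (@le_trans _ _ (\int[P]_(x in A) (l * (k x * one x)))).
    apply: le_Rintegral => //.
    - exact: (integrableB mA fi gi).
    - exact: (integrableZl mA l ik1).
    - move=> x Ax; rewrite /= /one mulr1 /k; apply: (le_trans (ler_norm _)).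
      have := fg _ Ax; move: l0; rewrite le_eqVlt => /predU1P[<-|l0 _].
        by rewrite !mul0r.
      by rewrite mulVKf ?gt_eqF.
  by rewrite RintegralZl// ler_wpM2l.
have -> : \int[P]_(x in A) (f x + a x ^+ 2) -
    \int[P]_(x in A) (g x + b x ^+ 2) =
    \int[P]_(x in A) (f x - g x) +
    (2 * \int[P]_(x in A) (b x * h x) + \int[P]_(x in A) (h x ^+ 2)).
  rewrite (RintegralD mA fi ia2) (RintegralD mA gi ib2) (RintegralB mA fi gi).
  have -> : \int[P]_(x in A) (a x ^+ 2) =
      \int[P]_(x in A) (b x ^+ 2 + 2 * (b x * h x) + h x ^+ 2).
    by apply: eq_Rintegral => x _; rewrite /h; ring.
  have i2bh : P.-integrable A (EFin \o (fun x => 2 * (b x * h x))).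
    exact: (integrableZl mA 2 ibh).
  rewrite (RintegralD mA (integrableD mA ib2 i2bh) ih2).
  rewrite (RintegralD mA ib2 i2bh) (RintegralZl _ mA ibh); ring.
lra.
Qed.

Lemma gradB (R : realType) (d n : nat) (u v : vfun R d n) (x : 'rV[R]_d) :
  has_grad u x -> has_grad v x ->
  grad (fun z => u z - v z) x = grad u x - grad v x.
Proof.
move=> du dv; apply/matrixP => j i; rewrite !mxE.
by rewrite (_ : (fun z => u z - v z) = u - v)// deriveB// !mxE.
Qed.

Lemma expected_tik_sub_le (R : realType) (d n : nat) (Y : Type)
    (Om : set (borel R d)) (rho : probability (borel R d) R)
    (D : 'rV[R]_n -> Y -> R) (y : 'rV[R]_d -> Y) (u w : vfun R d n)
    (lambda e : R) :
  measurable Om -> 0 <= lambda -> 0 <= e ->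
  admissible Om rho D y u -> admissible Om rho D y w ->
  (forall x, Om x ->
     `|D (u x) (y x) - D (w x) (y x)| <= lambda * l2norm (u x - w x)) ->
  (H1norm2 Om rho (fun x => (u x - w x)%R) <= (e ^+ 2)%:E)%E ->
  expected_tik Om rho D y u - expected_tik Om rho D y w
    <= (lambda + 2 * grad_L2norm Om rho w) * e + e ^+ 2.
Proof.
move=> mOm l0 e0 [gu iDu igu] [gw iDw igw] lip H1.
pose F x : R := l2norm (u x - w x) ^+ 2 +
  l2norm (grad (fun z => u z - w z) x) ^+ 2.
apply: (@Rintegral_add_sqr_sub_le _ _ _ rho Om (fun x => D (u x) (y x))
  (fun x => D (w x) (y x)) (fun x => l2norm (u x - w x))
  (fun x => l2norm (grad u x)) (fun x => l2norm (grad w x)) F lambda e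
  mOm l0 e0 iDu iDw _ igu _ igw _ lip _ _ H1) => [x|x|x|x Ox|].
- exact: l2norm_ge0.
- exact: l2norm_ge0.
- exact: l2norm_ge0.
- by rewrite lerDl sqr_ge0.
(* The gradient of the difference splits only where both gradients exist, hence almost
   everywhere. *)
- move: gu gw; apply: (filterS2 (ae_filter_ringOfSetsType rho)) => x gux gwx Ox.
  rewrite /F gradB; [|exact: gux|exact: gwx].
  by rewrite ler_wpDl ?sqr_ge0// ler_sqr_dist_l2norm.
Qed.

(** * Approximate minimizers and events of high probability *)

Lemma delta_minimizer_le (R : realType) (T : Type) (L : T -> R) (W : set T)
    (delta : R) (w v : T) :
  delta_minimizer L W delta w -> W v -> L w <= L v + delta.
Proof.
move=> [_ Lw] Wv; rewrite -lee_fin EFinD; apply: (le_trans Lw).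
by rewrite leeD2r//; apply: ereal_inf_lbound; exists v.
Qed.

(** The chain is [L w <= L' w + c <= L' v + delta + c <= L v + delta + 2 * c]: the uniform error is
    paid once at [w] and once at [v]. *)
Lemma delta_minimizer_approx (R : realType) (T : Type) (L L' : T -> R)
    (W : set T) (delta c : R) (w v : T) :
  delta_minimizer L' W delta w -> W v ->
  (ereal_sup [set `|L u - L' u|%:E | u in W] <= c%:E)%E ->
  L w <= L v + delta + 2 * c.
Proof.
move=> Lw Wv LL'.
have dist u : W u -> `|L u - L' u| <= c.
  move=> Wu; rewrite -lee_fin; apply: le_trans LL'.
  by apply: ereal_sup_ubound; exists u.
have := dist _ Lw.1; have := dist _ Wv; rewrite !ler_distl.
have := delta_minimizer_le Lw Wv; lra.
Qed.

(** Removing a null set from the measurable event inside [A] leaves its probability unchanged. This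
    combines the quadrature event with the almost sure minimality of [phihatN]. *)
Lemma with_prob_ge_ae (R : realType) (dT : measure_display)
    (T : measurableType dT) (P : probability T R) (p : R) (A B : set T)
    (Q : T -> Prop) :
  {ae P, forall t, Q t} -> with_prob_ge P p A ->
  (forall t, A t -> Q t -> B t) -> with_prob_ge P p B.
Proof.
move=> [N [mN PN QN]] [E [mE EA] pE] AQB; exists (E `\` N).
  split; first exact: measurableD.
  move=> t [Et Nt]; apply: AQB; first exact: EA.
  by apply/not_notP => nQ; apply: Nt; exact: QN.
move: pE; rewrite (measureDI P mE mN) [X in (_ + X)%E](_ : _ = 0%E) ?adde0//.
by apply: subset_measure0 PN => //; exact: measurableI.
Qed.

Unset Implicit Arguments.
Set Strict Implicit.

Theorem theorem4 (R : realType) (d n : nat) (n_ge1 : (1 <= n)%N)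
    (Om : set 'rV[R]_d) (HOm : bounded_domain Om)
    (rho : probability (borel R d) R) (rho_Om : rho Om = 1%E)
    (Y : Type) (y : 'rV[R]_d -> Y) (D : 'rV[R]_n -> Y -> R)
    (U V : set (vfun R d n))
    (HU : forall u, U u -> admissible Om rho D y u) (HVU : V `<=` U)
    (* D is Lipschitz in its first argument *)
    (lambda : R) (lambda_ge0 : 0 <= lambda)
    (HD : forall u1 u2, U u1 -> U u2 -> forall x, Om x ->
       `|D (u1 x) (y x) - D (u2 x) (y x)| <= lambda * l2norm (u1 x - u2 x))
    (* the i.i.d. samples *)
    (N : nat) (N_gt0 : (0 < N)%N)
    (dT : measure_display) (T : measurableType dT) (P : probability T R)
    (X : 'I_N -> {RV P >-> borel R d}) (HX : iid_sample X rho)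
    (* the minimizers *)
    (delta : R) (delta_ge0 : 0 <= delta)
    (uhat phihat : vfun R d n) (phihatN : T -> vfun R d n)
    (Huhat : minimizer (expected_tik Om rho D y) U uhat)
    (Hphihat : delta_minimizer (expected_tik Om rho D y) V delta phihat)
    (HphihatN : {ae P, forall t,
       delta_minimizer (empirical_tik D y (fun i => X i t)) V delta (phihatN t)})
    (* the given normed space containing uhat *)
    (W : normedModType R) (S : set (vfun R d n)) (iota : vfun R d n -> W)
    (HS : functions_in_normed_space Om S iota) (Suhat : S uhat)
    (C1 m gamma : R) (C1_ge0 : 0 <= C1) (m_gt0 : 0 < m)
    (C2 : set (vfun R d n) -> R -> R -> R)
    (A1 : exists2 phi, V phi &
       (H1norm2 Om rho (fun x => (phi x - uhat x)%R)
          <= (C1 ^+ 2 * `|iota uhat| ^+ 2 / m `^ gamma)%R%:E)%E)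
    (A2 : forall eps : R, 0 < eps -> eps < 1 ->
       with_prob_ge P (1 - eps)
         [set t | (ereal_sup
            [set `|expected_tik Om rho D y phi
                   - empirical_tik D y (fun i => X i t) phi|%R%:E | phi in V]
            <= (C2 V m eps / Num.sqrt N%:R)%R%:E)%E]) :
  let L := expected_tik Om rho D y in
  let B := (lambda + 2 * grad_L2norm Om rho uhat) * C1
             * (`|iota uhat| / m `^ (gamma / 2))
           + C1 ^+ 2 * (`|iota uhat| ^+ 2 / m `^ gamma) in
  (0 <= L phihat - L uhat /\ L phihat - L uhat <= B + delta) /\
  (forall eps : R, 0 < eps -> eps < 1 ->
     with_prob_ge P (1 - eps)
       [set t | 0 <= L (phihatN t) - L uhat /\
                L (phihatN t) - L uhat
                  <= B + 2 * C2 V m eps / Num.sqrt N%:R + 2 * delta]).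
Proof.
move=> L B.
have mOm : measurable (Om : set (borel R d)).
  by apply: sub_sigma_algebra; case: HOm.
have [Uu umin] := Huhat.
have [phi Vphi Hphi] := A1.
(* The square root of the bound in [A1], since squaring turns the exponent [gamma / 2] into
   [gamma]. *)
pose e := C1 * (`|iota uhat| / m `^ (gamma / 2)).
have e0 : 0 <= e by rewrite mulr_ge0// divr_ge0// powR_ge0.
have eE : e ^+ 2 = C1 ^+ 2 * `|iota uhat| ^+ 2 / m `^ gamma.
  rewrite /e !exprMn exprVn mulrA; congr (_ / _).
  by rewrite -powR_mulrn ?powR_ge0// -powRrM divfK// pnatr_eq0.
have LB : L phi - L uhat <= B.
  have -> : B = (lambda + 2 * grad_L2norm Om rho uhat) * e + e ^+ 2.
    by rewrite eE /B /e !mulrA.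
  apply: expected_tik_sub_le => //.
  - exact/HU/HVU.
  - exact: HU.
  - by apply: HD => //; exact: HVU.
  - by rewrite eE.
have Lge0 v : V v -> 0 <= L v - L uhat.
  by move=> Vv; rewrite subr_ge0; exact/umin/HVU.
split.
  split; first exact: Lge0 Hphihat.1.
  rewrite lerBlDr; apply: (le_trans (delta_minimizer_le Hphihat Vphi)).
  by rewrite addrAC lerD2r -lerBlDr.
move=> eps eps0 eps1.
apply: (with_prob_ge_ae HphihatN (A2 _ eps0 eps1)) => t /= At Ht.
split; first exact: Lge0 Ht.1.
rewrite lerBlDr -[2 * _ / _]mulrA.
apply: (le_trans (delta_minimizer_approx Ht Vphi At)).
have Lphi : L phi <= L uhat + B by rewrite addrC -lerBlDr.
apply: (@le_trans _ _ (L uhat + B + delta + 2 * (C2 V m eps / Num.sqrt N%:R))).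
  by rewrite !lerD2r.
(* The chain costs a single [delta]; [delta_ge0] gives the stated [2 * delta]. *)
move: (L uhat) (B) (C2 _ _ _ / _) delta_ge0 => Lu b c; clear; lra.
Qed.
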